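(* Let $\mathrm{CS}$ be an arbitrary constant specification for $\mathsf{JTO}$. Define $$\mathtt{contract}:=\boxdot(\mathtt{winfirst}_e\leftrightarrow[\mathtt a]^{\mathcal O}_e\mathtt{pay}),$$ $$\mathtt{court}:=\mathtt{true}_{10}\big[(\neg\mathtt{win}_p\leftrightarrow\mathtt{winfirst}_e)\wedge(\mathtt{win}_p\to[\mathtt v_p]^{\mathcal O}_e\mathtt{pay})\wedge(\neg\mathtt{win}_p\to\neg[\mathtt v_e]^{\mathcal O}_e\mathtt{pay})\big],$$ $$\mathtt{Nowin}':=\mathtt{true}_{10}(\blacksquare\mathsf Y_w\neg\mathtt{winfirst}_e),\qquad \mathtt{PastLooking}:=\mathtt{true}_{10}(\blacksquare\mathsf Y_w\neg\mathtt{winfirst}_e\to\neg\mathtt{win}_p).$$ Then $$\mathtt{contract},\ \mathtt{court},\ \mathtt{Nowin}',\ \mathtt{PastLooking}\ \vdash_{\mathrm{CS}}\ \mathtt{true}_{10}(\neg\mathtt{win}_p\wedge\mathtt{winfirst}_e\wedge[\mathtt a]^{\mathcal O}_e\mathtt{pay}).$$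
   Context: **Language.** The set of agents is $\mathrm{Ag}=\{p,e,j\}$ (Protagoras, Euathlus, judge); $\mathrm{Const},\mathrm{Var},\mathrm{Prop}$ are countable sets of justification constants, justification variables and atomic propositions. $\mathrm{Prop}$ contains distinct atoms $\mathtt{win}_p$, $\mathtt{winfirst}_e$, $\mathtt{pay}$, and $\mathrm{Var}$ contains distinct variables $\mathtt a$ (the agreement), $\mathtt v_p$, $\mathtt v_e$ (the judge's verdict in favor of Protagoras, resp. Euathlus). Epistemic terms: $t::=c\mid x\mid {!t}\mid t+t\mid t\cdot t$. Normative terms: $s::=c\mid x\mid \ddagger s\mid s\cdot s$ ($c\in\mathrm{Const}$, $x\in\mathrm{Var}$). Formulas: $\varphi::=q\mid\bot\mid\varphi\to\varphi\mid\bigcirc\varphi\mid\mathsf Y_w\varphi\mid\varphi\,\mathcal U\,\varphi\mid\varphi\,\mathcal S\,\varphi\mid[t]_i\varphi\mid[s]^{\mathcal O}_i\varphi$ ($q\in\mathrm{Prop}$, $i\in\mathrm{Ag}$, $t$ epistemic, $s$ normative). Abbreviations: $\neg\varphi:=\varphi\to\bot$, $\top:=\neg\bot$, $\varphi\vee\psi:=\neg\varphi\to\psi$, $\varphi\wedge\psi:=\neg(\neg\varphi\vee\neg\psi)$, $\leftrightarrow$ as usual, $\mathsf Y_s\varphi:=\neg\mathsf Y_w\neg\varphi$, $\Diamond\varphi:=\top\,\mathcal U\,\varphi$, $\Box\varphi:=\neg\Diamond\neg\varphi$, $\blacksquare\varphi:=\neg(\top\,\mathcal S\,\neg\varphi)$,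 $\boxdot\varphi:=\blacksquare\varphi\wedge\Box\varphi$, $\langle s\rangle^{\mathcal P}_i\varphi:=\neg[s]^{\mathcal O}_i\neg\varphi$; for $m\in\mathbb N$, $(\mathtt{time}=m):=\mathsf Y_s^m\mathsf Y_w\bot$ ($m$-fold $\mathsf Y_s$) and $\mathtt{true}_m(\varphi):=\boxdot(\mathtt{time}=m\to\varphi)$. **Axioms** (all instances, all $i\in\mathrm{Ag}$): propositional tautologies; $\ast(\varphi\to\psi)\to(\ast\varphi\to\ast\psi)$ for $\ast\in\{\bigcirc,\Box,\blacksquare,\mathsf Y_w\}$; $\bigcirc\neg\varphi\leftrightarrow\neg\bigcirc\varphi$; $\Box(\varphi\to\bigcirc\varphi)\to(\varphi\to\Box\varphi)$; $\varphi\,\mathcal U\,\psi\to\Diamond\psi$; $\varphi\,\mathcal U\,\psi\leftrightarrow\psi\vee(\varphi\wedge\bigcirc(\varphi\,\mathcal U\,\psi))$; $\mathsf Y_s\varphi\to\mathsf Y_w\varphi$; $\top\,\mathcal S\,\mathsf Y_w\bot$; $\blacksquare(\varphi\to\mathsf Y_w\varphi)\to(\varphi\to\blacksquare\varphi)$; $(\varphi\,\mathcal S\,\psi)\to(\top\,\mathcal S\,\psi)$; $\varphi\,\mathcal S\,\psi\leftrightarrow\psi\vee(\varphi\wedge\mathsf Y_s(\varphi\,\mathcal S\,\psi))$; $\varphi\to\bigcirc\mathsf Y_s\varphi$; $\varphi\to\mathsf Y_w\bigcirc\varphi$; $[t]_i(\varphi\to\psi)\to([s]_i\varphi\to[t\cdot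 s]_i\psi)$; $[t]_i\varphi\to[t+s]_i\varphi$; $[s]_i\varphi\to[t+s]_i\varphi$; $[t]_i\varphi\to\varphi$; $[t]_i\varphi\to[!t]_i[t]_i\varphi$; $[t]^{\mathcal O}_i(\varphi\to\psi)\to([s]^{\mathcal O}_i\varphi\to[t\cdot s]^{\mathcal O}_i\psi)$; $[t]^{\mathcal O}_i\varphi\to\langle t\rangle^{\mathcal P}_i\varphi$; $[\ddagger t]^{\mathcal O}_i([t]^{\mathcal O}_i\varphi\to\varphi)$. **Constant specifications.** A constant specification $\mathrm{CS}$ is a set of formulas of the form $[c_n]_{i_n}\cdots[c_1]_{i_1}\varphi$ or $[c_n]^{\mathcal O}_{i_n}\cdots[c_1]^{\mathcal O}_{i_1}\varphi$ with $n\ge1$, $c_k\in\mathrm{Const}$, $i_k\in\mathrm{Ag}$, $\varphi$ an axiom instance, which is downward closed: for $n>1$, if such a formula is in $\mathrm{CS}$, so is the one obtained by deleting its outermost operator. **Derivability.** $\vdash_{\mathrm{CS}}$ is derivability in the Hilbert system $\mathsf{JTO}_{\mathrm{CS}}$ with these axioms, modus ponens, necessitation (from $\vdash\varphi$ infer $\vdash\ast\varphi$) for $\ast\in\{\bigcirc,\mathsf Y_w,\Box,\blacksquare\}$, and: infer $\vdash\varphi$ for each $\varphi\in\mathrm{CS}$. $T\vdash_{\mathrm{CS}}\varphi$ means $\vdash_{\mathrm{CS}}(\psi_1\wedge\dots\wedge\psi_k)\to\varphi$ for some $\psi_1,\dots,\psi_k\in T$. *)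

(* Defs.v *)
From Stdlib Require List.
From mathcomp Require Import all_boot.
From mathcomp Require Import classical_sets.

Set Implicit Arguments.
Unset Strict Implicit.
Unset Printing Implicit Defensive.

Local Open Scope classical_set_scope.

Inductive agent : Set := Protagoras | Euathlus | Judge.

(* C, V and P stand for the sets Const, Var and Prop of justification
   constants, justification variables and atomic propositions. *)

(* Epistemic terms: c, x, !t, t + t, t . t *)
Inductive eterm (C V : Type) : Type :=
| EConst (c : C)
| EVar (x : V)
| EBang (t : eterm C V)
| ESum (t s : eterm C V)
| EApp (t s : eterm C V).

(* Normative terms: c, x, double-dagger s, s . s (there is no sum) *)
Inductive nterm (C V : Type) : Type :=
| NConst (c : C)
| NVar (x : V)
| NDag (s : nterm C V)
| NApp (t s : nterm C V).

Inductive formula (C V P : Type) : Type :=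
| Atom (q : P)
| Bot
| Imp (A B : formula C V P)
| Next (A : formula C V P)
| Yw (A : formula C V P)                            (* weak previous *)
| Until (A B : formula C V P)
| Since (A B : formula C V P)
| EBox (t : eterm C V) (i : agent) (A : formula C V P)   (* [t]_i A *)
| OBox (s : nterm C V) (i : agent) (A : formula C V P).  (* [s]^O_i A *)

Arguments EConst {C V} c.
Arguments EVar {C V} x.
Arguments NConst {C V} c.
Arguments NVar {C V} x.
Arguments Atom {C V P} q.
Arguments Bot {C V P}.

Declare Scope jto_scope.
Delimit Scope jto_scope with J.
Bind Scope jto_scope with formula.
Local Open Scope jto_scope.

Definition Neg {C V P} (A : formula C V P) : formula C V P := Imp A Bot.
Definition Top {C V P} : formula C V P := Neg Bot.
Definition Or {C V P} (A B : formula C V P) : formula C V P := Imp (Neg A) B.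
Definition And {C V P} (A B : formula C V P) : formula C V P :=
  Neg (Or (Neg A) (Neg B)).
Definition Iff {C V P} (A B : formula C V P) : formula C V P :=
  And (Imp A B) (Imp B A).

(* Conjunction and implication associate to the right. *)
Notation "A ~> B" := (Imp A B) (at level 90, right associativity) : jto_scope.
Notation "~ A" := (Neg A) : jto_scope.
Notation "A \/ B" := (Or A B) : jto_scope.
Notation "A /\ B" := (And A B) : jto_scope.
Notation "A <-> B" := (Iff A B) : jto_scope.

(* Strong previous *)
Definition Ys {C V P} (A : formula C V P) : formula C V P := ~ Yw (~ A).
Definition Diamond {C V P} (A : formula C V P) : formula C V P := Until Top A.
Definition Box {C V P} (A : formula C V P) : formula C V P := ~ Diamond (~ A).
(* "A has always held, now included" *)
Definition BlackBox {C V P} (A : formula C V P) : formula C V P :=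
  ~ Since Top (~ A).
(* "A holds at all times" *)
Definition BoxDot {C V P} (A : formula C V P) : formula C V P :=
  BlackBox A /\ Box A.
Definition PDia {C V P} (s : nterm C V) (i : agent) (A : formula C V P) :
  formula C V P := ~ OBox s i (~ A).

Definition time_is {C V P} (m : nat) : formula C V P := iter m Ys (Yw Bot).
Definition true_at {C V P} (m : nat) (A : formula C V P) : formula C V P :=
  BoxDot (time_is m ~> A).

(* Boolean evaluation in which every formula that is neither Bot nor an
   implication is treated as a propositional atom. *)
Fixpoint peval {C V P} (v : formula C V P -> bool) (A : formula C V P) : bool :=
  match A with
  | Bot => false
  | Imp B D => peval v B ==> peval v D
  | _ => v A
  end.

Definition tautology {C V P} (A : formula C V P) : Prop :=
  forall v : formula C V P -> bool, peval v A.

(* The modalities for which the K axiom and necessitation are postulated *)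
Inductive normal_modality {C V P} : (formula C V P -> formula C V P) -> Prop :=
| NM_Next : normal_modality (@Next C V P)
| NM_Box : normal_modality Box
| NM_BlackBox : normal_modality BlackBox
| NM_Yw : normal_modality (@Yw C V P).

Inductive jto_axiom {C V P} : set (formula C V P) :=
| AxTaut A : tautology A -> jto_axiom A
| AxK M A B : normal_modality M -> jto_axiom (M (A ~> B) ~> (M A ~> M B))
| AxFun A : jto_axiom (Next (~ A) <-> ~ Next A)
| AxInd A : jto_axiom (Box (A ~> Next A) ~> (A ~> Box A))
| AxUntil1 A B : jto_axiom (Until A B ~> Diamond B)
| AxUntil2 A B : jto_axiom (Until A B <-> (B \/ (A /\ Next (Until A B))))
| AxYsYw A : jto_axiom (Ys A ~> Yw A)
| AxInit : jto_axiom (Since Top (Yw Bot))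
| AxPastInd A : jto_axiom (BlackBox (A ~> Yw A) ~> (A ~> BlackBox A))
| AxSince1 A B : jto_axiom (Since A B ~> Since Top B)
| AxSince2 A B : jto_axiom (Since A B <-> (B \/ (A /\ Ys (Since A B))))
| AxNextYs A : jto_axiom (A ~> Next (Ys A))
| AxYwNext A : jto_axiom (A ~> Yw (Next A))
| AxEApp t s i A B :
    jto_axiom (EBox t i (A ~> B) ~> (EBox s i A ~> EBox (EApp t s) i B))
| AxESumL t s i A : jto_axiom (EBox t i A ~> EBox (ESum t s) i A)
| AxESumR t s i A : jto_axiom (EBox s i A ~> EBox (ESum t s) i A)
| AxEFact t i A : jto_axiom (EBox t i A ~> A)
| AxEBang t i A : jto_axiom (EBox t i A ~> EBox (EBang t) i (EBox t i A))
| AxNApp t s i A B :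
    jto_axiom (OBox t i (A ~> B) ~> (OBox s i A ~> OBox (NApp t s) i B))
| AxND t i A : jto_axiom (OBox t i A ~> PDia t i A)
| AxNDag t i A : jto_axiom (OBox (NDag t) i (OBox t i A ~> A)).

Local Close Scope jto_scope.

(* For l = [:: (c_n, i_n); ...; (c_1, i_1)], the formulas
   [c_n]_{i_n} ... [c_1]_{i_1} A  and  [c_n]^O_{i_n} ... [c_1]^O_{i_1} A *)
Definition eprefix {C V P} (l : seq (C * agent)) (A : formula C V P) :
  formula C V P := foldr (fun ci B => EBox (EConst ci.1) ci.2 B) A l.
Definition nprefix {C V P} (l : seq (C * agent)) (A : formula C V P) :
  formula C V P := foldr (fun ci B => OBox (NConst ci.1) ci.2 B) A l.

Record constant_specification {C V P} (CS : set (formula C V P)) : Prop := {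
  cs_shape : forall F, CS F ->
    exists (l : seq (C * agent)) (A : formula C V P),
      (0 < size l)%N /\ jto_axiom A /\ (F = eprefix l A \/ F = nprefix l A);
  cs_downward_e : forall ci l A, (0 < size l)%N -> jto_axiom A ->
    CS (eprefix (ci :: l) A) -> CS (eprefix l A);
  cs_downward_n : forall ci l A, (0 < size l)%N -> jto_axiom A ->
    CS (nprefix (ci :: l) A) -> CS (nprefix l A)
}.

Inductive provable {C V P} (CS : set (formula C V P)) : set (formula C V P) :=
| PrAx A : jto_axiom A -> provable CS A
| PrMP A B : provable CS (A ~> B)%J -> provable CS A -> provable CS B
| PrNec M A : normal_modality M -> provable CS A -> provable CS (M A)
| PrCS A : CS A -> provable CS A.

(* The empty conjunction is Top. *)
Fixpoint bigAnd {C V P} (l : seq (formula C V P)) : formula C V P :=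
  match l with
  | [::] => Top
  | [:: A] => A
  | A :: l' => (A /\ bigAnd l')%J
  end.

Definition derivable {C V P} (CS T : set (formula C V P)) (A : formula C V P) :
  Prop :=
  exists l : seq (formula C V P), List.Forall T l /\ provable CS (bigAnd l ~> A)%J.

Local Open Scope jto_scope.

Definition contract {C V P} (winfirst_e pay : P) (a : V) : formula C V P :=
  BoxDot (Atom winfirst_e <-> OBox (NVar a) Euathlus (Atom pay)).

Definition court {C V P} (win_p winfirst_e pay : P) (v_p v_e : V) :
  formula C V P :=
  true_at 10
    ((~ Atom win_p <-> Atom winfirst_e)
     /\ (Atom win_p ~> OBox (NVar v_p) Euathlus (Atom pay))
     /\ (~ Atom win_p ~> ~ OBox (NVar v_e) Euathlus (Atom pay))).

Definition Nowin' {C V P} (winfirst_e : P) : formula C V P :=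
  true_at 10 (BlackBox (Yw (~ Atom winfirst_e))).

Definition PastLooking {C V P} (win_p winfirst_e : P) : formula C V P :=
  true_at 10 (BlackBox (Yw (~ Atom winfirst_e)) ~> ~ Atom win_p).

(* Main.v *)
(** The "always" modality [BoxDot] is normal, being a conjunction of the normal
    modalities [BlackBox] and [Box].  All premises and the conclusion are
    [BoxDot]-formulas, and the formula under [BoxDot] in the conclusion is a
    tautological consequence of those under [BoxDot] in the premises. *)

Require Import Defs.
From mathcomp Require Import all_boot.
From mathcomp Require Import classical_sets.

Local Open Scope classical_set_scope.

Section NormalModalities.
Context {C V P : Type} (CS : set (formula C V P)).
Implicit Types (A B D : formula C V P) (l : seq (formula C V P)).

Lemma provable_taut1 A B :
  tautology (A ~> B)%J -> provable CS A -> provable CS B.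
Proof. by move=> tAB; apply: PrMP; apply: PrAx; apply: AxTaut. Qed.

Lemma provable_taut2 A B D :
  tautology (A ~> B ~> D)%J -> provable CS A -> provable CS B -> provable CS D.
Proof. by move=> tABD pA; apply: PrMP; apply: provable_taut1 pA. Qed.

Lemma peval_imp v A B : peval v (A ~> B)%J = (peval v A ==> peval v B).
Proof. by []. Qed.

Lemma peval_and v A B : peval v (A /\ B)%J = peval v A && peval v B.
Proof. by rewrite /=; case: (peval v A); case: (peval v B). Qed.

(** The case split on [l] is needed because [bigAnd] returns a singleton unchanged, without a
    trailing [Top]; the two agree only after evaluation. *)
Lemma peval_bigAnd_cons v A l :
  peval v (bigAnd (A :: l)) = peval v A && peval v (bigAnd l).
Proof. by case: l => [|B l]; rewrite ?peval_and //= andbT. Qed.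

Lemma provable_bigAnd_cons A l B :
  provable CS (bigAnd (A :: l) ~> B)%J <->
  provable CS (bigAnd l ~> A ~> B)%J.
Proof.
split; apply: provable_taut1 => v; rewrite !peval_imp peval_bigAnd_cons.
all: by case: (peval v A); case: (peval v (bigAnd l)); case: (peval v B).
Qed.

Lemma provable_imp_trans A B D :
  provable CS (A ~> B)%J -> provable CS (B ~> D)%J -> provable CS (A ~> D)%J.
Proof.
apply: provable_taut2 => v /=.
by case: (peval v A); case: (peval v B); case: (peval v D).
Qed.

(** Induction on [l] for all [B]: the head [A] is curried into the conclusion, the induction
    hypothesis gives [M (A ~> B)], and K distributes [M] over it. Necessitation and K are taken as
    hypotheses, so that [M] may be a derived modality such as [BoxDot], which is not a
    [normal_modality]. *)
Lemma normal_bigAnd (M : formula C V P -> formula C V P) l B :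
    (forall A, provable CS A -> provable CS (M A)) ->
    (forall A D, provable CS (M (A ~> D) ~> M A ~> M D)%J) ->
  provable CS (bigAnd l ~> B)%J ->
  provable CS (bigAnd (map M l) ~> M B)%J.
Proof.
move=> Mnec MK; elim: l B => [|A l IHl] B.
  (* The empty conjunction is [Top]: it is discharged before necessitation and put back
     afterwards. *)
  move=> pB; have {}pB : provable CS B.
    by apply: provable_taut1 pB => v /=; exact: implybb.
  by apply: provable_taut1 (Mnec _ pB) => v /=; exact: implybb.
move=> /provable_bigAnd_cons/IHl pl; apply/provable_bigAnd_cons.
exact: provable_imp_trans pl (MK A B).
Qed.

Lemma taut_and A B : tautology (A ~> B ~> (A /\ B))%J.
Proof. by move=> v /=; case: (peval v A); case: (peval v B). Qed.

Lemma BoxDot_nec A : provable CS A -> provable CS (BoxDot A).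
Proof.
move=> pA; apply: provable_taut2; first exact: taut_and.
- exact: PrNec NM_BlackBox pA.
- exact: PrNec NM_Box pA.
Qed.

(** Merges the K axioms of [BlackBox] and [Box] componentwise into K for [BoxDot]. *)
Lemma taut_imp_and A1 B1 D1 A2 B2 D2 :
  tautology ((A1 ~> B1 ~> D1) ~> (A2 ~> B2 ~> D2) ~>
             ((A1 /\ A2) ~> (B1 /\ B2) ~> (D1 /\ D2)))%J.
Proof.
move=> v /=.
by case: (peval v A1); case: (peval v B1); case: (peval v D1);
   case: (peval v A2); case: (peval v B2); case: (peval v D2).
Qed.

Lemma BoxDot_K A B : provable CS (BoxDot (A ~> B) ~> BoxDot A ~> BoxDot B)%J.
Proof.
apply: provable_taut2; first exact: taut_imp_and.
- by apply: PrAx; apply: AxK; exact: NM_BlackBox.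
- by apply: PrAx; apply: AxK; exact: NM_Box.
Qed.

(** [T] stands for time 10, [N] for the absence of an earlier first win, [W] and [F] for the two win
    atoms, and [O], [G], [H] for the obligations to pay under [a], [v_p], [v_e]. Given [T], the last
    two premises yield [~ W], the court then yields [F], and the contract yields [O]. *)
Lemma paradox_taut T N W F O G H :
  tautology (bigAnd [:: F <-> O;
                        T ~> ((~ W <-> F) /\ (W ~> G) /\ (~ W ~> ~ H));
                        T ~> N;
                        T ~> N ~> ~ W]
             ~> (T ~> (~ W /\ F /\ O)) : formula C V P)%J.
Proof.
move=> v /=.
by case: (peval v T); case: (peval v N); case: (peval v W); case: (peval v F);
   case: (peval v O); case: (peval v G); case: (peval v H).
Qed.

End NormalModalities.

Theorem theorem7p7 (Const Var Prp : countType)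
    (win_p winfirst_e pay : Prp) (a v_p v_e : Var)
    (distinct_atoms : uniq [:: win_p; winfirst_e; pay])
    (distinct_vars : uniq [:: a; v_p; v_e])
    (CS : set (formula Const Var Prp))
    (CS_spec : constant_specification CS) :
  derivable CS
    [set contract winfirst_e pay a;
         court win_p winfirst_e pay v_p v_e;
         Nowin' winfirst_e;
         PastLooking win_p winfirst_e]
    (true_at 10
       (~ Atom win_p /\ Atom winfirst_e
        /\ OBox (NVar a) Euathlus (Atom pay))%J).
Proof.
exists [:: contract winfirst_e pay a; court win_p winfirst_e pay v_p v_e;
           Nowin' winfirst_e; PastLooking win_p winfirst_e]; split.
  apply: List.Forall_cons; first by left; left; left.
  apply: List.Forall_cons; first by left; left; right.
  apply: List.Forall_cons; first by left; right.
  by apply: List.Forall_cons; first by right.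
(* The explicit list shape lets unification unfold each premise to a [BoxDot] and read off its
   body. *)
apply: (@normal_bigAnd _ _ _ CS BoxDot [:: _; _; _; _]).
- exact: BoxDot_nec.
- exact: BoxDot_K.
- by apply: PrAx; apply: AxTaut; exact: paradox_taut.
Qed.
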